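(* Let $(\mathbb{C},\mathcal{N})$ be a regular multi-pointed category with kernels. The following statements are equivalent: (a) $\mathbb{C}$ is a $2$-star-permutable category, i.e. $\mathsf{Eq}(f)\,\mathsf{Eq}(g)^{\ast}=\mathsf{Eq}(g)\,\mathsf{Eq}(f)^{\ast}$ for any pair of regular epimorphisms $f$ and $g$ in $\mathbb{C}$ with the same domain; (b) every split square in $\mathbb{C}$ is a star-regular pushout; that is, for all morphisms $c\colon C\to A$, $d\colon D\to B$, $g\colon C\to D$, $t\colon D\to C$, $f\colon A\to B$, $s\colon B\to A$ in $\mathbb{C}$ with $c$ and $d$ regular epimorphisms, $g\cdot t=1_D$, $f\cdot s=1_B$, $f\cdot c=d\cdot g$ and $c\cdot t=s\cdot d$, one has the equality of relations from $D$ to $A$ $$c\,{g^{\circ}}^{\ast}=f^{\circ}d^{\ast}.$$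
   Context: A regular category is a finitely complete category in which every kernel pair has a coequaliser and regular epimorphisms are stable under pullback. An ideal $\mathcal{N}$ in $\mathbb{C}$ is a class of morphisms such that, for any composable pair $g,f$, if $g\in\mathcal{N}$ or $f\in\mathcal{N}$ then $g\cdot f\in\mathcal{N}$. A multi-pointed category is a finitely complete category equipped with an ideal $\mathcal{N}$. An $\mathcal{N}$-kernel of $f\colon X\to Y$ is a morphism $\mathrm{n}_f\colon \mathrm{N}_f\to X$ with $f\cdot \mathrm{n}_f\in\mathcal{N}$, universal with this property (every $h$ with $f\cdot h\in\mathcal{N}$ factors uniquely through $\mathrm{n}_f$); it is automatically a monomorphism. A regular multi-pointed category with kernels is a multi-pointed category whose underlying category is regular and in which every morphism has an $\mathcal{N}$-kernel. Relations: a relation $\varrho$ from $X$ to $Y$ is a subobject $\langle\varrho_1,\varrho_2\rangle\colon R\rightarrowtail X\times Y$; its opposite $\varrho^{\circ}$ is the relation $\langle\varrho_2,\varrho_1\rangle$ from $Y$ to $X$. For $\sigma$ a relation from $Y$ to $Z$, $\sigma\varrho$ denotes the usual composite relation from $X$ to $Z$ (first $\varrho$, then $\sigma$). A morphism $f\colon X\to Y$ is identified with the relation $\langle 1_X,f\rangle$ from $X$ to $Y$. $\mathsf{Eq}(f)=f^{\circ}f$ is the kernel pair of $f$. Stars: $\Delta_X^{\ast}$ denotes the relation $(\mathrm{n}_{1_X},\mathrm{n}_{1_X})$ on $X$, where $\mathrm{n}_{1_X}$ is the $\mathcal{N}$-kernel of $1_X$. For a relation $\varrho$ from $X$ to $Y$,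 $\varrho^{\ast}=\varrho\,\Delta_X^{\ast}$; equivalently, $\varrho^\ast=(\varrho_1\cdot \mathrm{n}_{\varrho_1},\varrho_2\cdot \mathrm{n}_{\varrho_1})$, the largest subrelation of $\varrho$ whose first component is in $\mathcal{N}$. In particular ${g^{\circ}}^{\ast}=g^{\circ}\Delta_D^{\ast}$ and $d^{\ast}=d\,\Delta_D^{\ast}$. *)

(* Defs.v *)
Set Implicit Arguments.
Unset Strict Implicit.
Unset Printing Implicit Defensive.

Declare Scope cat_scope.
Delimit Scope cat_scope with cat.
Local Open Scope cat_scope.

(** * Categories, limits and colimits *)

Record category : Type := Category {
  obj :> Type;
  hom : obj -> obj -> Type;
  idm : forall X, hom X X;
  comp : forall X Y Z, hom Y Z -> hom X Y -> hom X Z;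
  comp_id_l : forall X Y (f : hom X Y), comp (idm Y) f = f;
  comp_id_r : forall X Y (f : hom X Y), comp f (idm X) = f;
  comp_assoc : forall X Y Z W (h : hom Z W) (g : hom Y Z) (f : hom X Y),
    comp h (comp g f) = comp (comp h g) f
}.

Arguments idm {c} X.
Arguments comp {c X Y Z} g f.
Notation "g ∘ f" := (comp g f) (at level 40, left associativity) : cat_scope.

Definition mono (C : category) (X Y : C) (m : hom X Y) : Prop :=
  forall (W : C) (u v : hom W X), m ∘ u = m ∘ v -> u = v.

(** Universal properties are [Type]-valued: they carry the mediating morphism. *)

Record is_terminal (C : category) (T : C) : Type := IsTerminal {
  to_terminal : forall X : C, hom X T;
  to_terminal_uniq : forall (X : C) (u v : hom X T), u = v
}.

Record is_pullback (C : category) (X Y Z P : C) (f : hom X Z) (g : hom Y Z)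
    (p1 : hom P X) (p2 : hom P Y) : Type := IsPullback {
  pb_comm : f ∘ p1 = g ∘ p2;
  pb_univ : forall (W : C) (h : hom W X) (k : hom W Y), f ∘ h = g ∘ k ->
    {u : hom W P | unique (fun u => p1 ∘ u = h /\ p2 ∘ u = k) u}
}.

Record is_coequaliser (C : category) (W X Q : C) (a b : hom W X)
    (q : hom X Q) : Type := IsCoequaliser {
  coeq_comm : q ∘ a = q ∘ b;
  coeq_univ : forall (Z : C) (h : hom X Z), h ∘ a = h ∘ b ->
    {u : hom Q Z | unique (fun u => u ∘ q = h) u}
}.

Definition regular_epi (C : category) (X Q : C) (q : hom X Q) : Prop :=
  exists (W : C) (a b : hom W X), inhabited (is_coequaliser a b q).

(** * Finitely complete and regular categories *)

(** Finite completeness is given by a terminal object and pullbacks; binary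
    products are the pullbacks over the terminal object. Limits, coequalisers and
    kernels are chosen; relations are compared as subobjects, so that the choice
    does not matter. *)
Record finitely_complete_category : Type := FinitelyCompleteCategory {
  fcat :> category;
  terminal : fcat;
  terminalP : is_terminal terminal;
  pb : forall (X Y Z : fcat) (f : hom X Z) (g : hom Y Z), fcat;
  pb1 : forall (X Y Z : fcat) (f : hom X Z) (g : hom Y Z), hom (pb f g) X;
  pb2 : forall (X Y Z : fcat) (f : hom X Z) (g : hom Y Z), hom (pb f g) Y;
  pbP : forall (X Y Z : fcat) (f : hom X Z) (g : hom Y Z),
    is_pullback f g (pb1 f g) (pb2 f g)
}.

Arguments terminal {_}.
Arguments terminalP {_}.

Section Products.
Context {C : finitely_complete_category}.

Definition toT (X : C) : hom X terminal := to_terminal terminalP X.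

Definition bprod (X Y : C) : C := pb (toT X) (toT Y).
Definition pr1 (X Y : C) : hom (bprod X Y) X := pb1 (toT X) (toT Y).
Definition pr2 (X Y : C) : hom (bprod X Y) Y := pb2 (toT X) (toT Y).

Definition pairing (W X Y : C) (h : hom W X) (k : hom W Y) : hom W (bprod X Y) :=
  proj1_sig (pb_univ (pbP (toT X) (toT Y))
    (to_terminal_uniq terminalP (toT X ∘ h) (toT Y ∘ k))).

Lemma pr1_pairing (W X Y : C) (h : hom W X) (k : hom W Y) :
  pr1 X Y ∘ pairing h k = h.
Proof. unfold pairing. now destruct pb_univ as [u [[H1 H2] Hu]]. Qed.

Lemma pr2_pairing (W X Y : C) (h : hom W X) (k : hom W Y) :
  pr2 X Y ∘ pairing h k = k.
Proof. unfold pairing. now destruct pb_univ as [u [[H1 H2] Hu]]. Qed.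

Lemma pb_ext (X Y Z P : C) (f : hom X Z) (g : hom Y Z) (p1 : hom P X)
    (p2 : hom P Y) (HP : is_pullback f g p1 p2) (W : C) (u v : hom W P) :
  p1 ∘ u = p1 ∘ v -> p2 ∘ u = p2 ∘ v -> u = v.
Proof.
intros H1 H2.
assert (E : f ∘ (p1 ∘ v) = g ∘ (p2 ∘ v)).
{ now rewrite !comp_assoc, (pb_comm HP). }
destruct (pb_univ HP E) as [w [_ Hw]].
now rewrite <- (Hw u), <- (Hw v).
Qed.

Lemma bprod_ext (W X Y : C) (u v : hom W (bprod X Y)) :
  pr1 X Y ∘ u = pr1 X Y ∘ v -> pr2 X Y ∘ u = pr2 X Y ∘ v -> u = v.
Proof. intros H1 H2; exact (pb_ext (pbP _ _) H1 H2). Qed.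

Lemma pairing_mono (R X Y : C) (r1 : hom R X) (r2 : hom R Y) :
  (forall (W : C) (u v : hom W R),
    r1 ∘ u = r1 ∘ v -> r2 ∘ u = r2 ∘ v -> u = v) ->
  mono (pairing r1 r2).
Proof.
intros H W u v E; apply H.
- now rewrite <- (pr1_pairing r1 r2), <- !comp_assoc, E.
- now rewrite <- (pr2_pairing r1 r2), <- !comp_assoc, E.
Qed.

End Products.

Record regular_category : Type := RegularCategory {
  rcat :> finitely_complete_category;
  coeq : forall (X Y : rcat) (f : hom X Y), rcat;
  coeq_map : forall (X Y : rcat) (f : hom X Y), hom X (coeq f);
  coeqP : forall (X Y : rcat) (f : hom X Y),
    is_coequaliser (pb1 f f) (pb2 f f) (coeq_map f);
  regular_epi_stable : forall (X Y Z P : rcat) (f : hom X Z) (g : hom Y Z)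
    (p1 : hom P X) (p2 : hom P Y),
    is_pullback f g p1 p2 -> regular_epi f -> regular_epi p2
}.

(** * Relations in a regular category *)

Section Relations.
Context {C : regular_category}.

Lemma regular_epi_epi (X Q Z : C) (q : hom X Q) (u v : hom Q Z) :
  regular_epi q -> u ∘ q = v ∘ q -> u = v.
Proof.
intros (W & a & b & [Hq]) E.
assert (E' : (v ∘ q) ∘ a = (v ∘ q) ∘ b).
{ now rewrite <- !comp_assoc, (coeq_comm Hq). }
destruct (coeq_univ Hq E') as [w [_ Hw]].
now rewrite <- (Hw u), <- (Hw v).
Qed.

Lemma coeq_map_regular (X Y : C) (f : hom X Y) : regular_epi (coeq_map f).
Proof. exists (pb f f), (pb1 f f), (pb2 f f); constructor; apply coeqP. Qed.

Definition img (X Y : C) (f : hom X Y) : hom (coeq f) Y :=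
  proj1_sig (coeq_univ (coeqP f) (pb_comm (pbP f f))).

Lemma img_coeq (X Y : C) (f : hom X Y) : img f ∘ coeq_map f = f.
Proof. unfold img. now destruct coeq_univ as [u [Hu Hu']]. Qed.

Lemma img_mono (X Y : C) (f : hom X Y) : mono (img f).
Proof.
intros W u v E.
pose (q := coeq_map f).
pose (x := pb1 q u). pose (e1 := pb2 q u).
pose (y := pb1 q (v ∘ e1)). pose (e2 := pb2 q (v ∘ e1)).
assert (Hx : q ∘ x = u ∘ e1) by exact (pb_comm (pbP q u)).
assert (Hy : q ∘ y = (v ∘ e1) ∘ e2) by exact (pb_comm (pbP q (v ∘ e1))).
assert (He1 : regular_epi e1).
{ exact (regular_epi_stable (pbP q u) (coeq_map_regular f)). }
assert (He2 : regular_epi e2).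
{ exact (regular_epi_stable (pbP q (v ∘ e1)) (coeq_map_regular f)). }
assert (K : f ∘ (x ∘ e2) = f ∘ y).
{ assert (Hf : img f ∘ q = f) by exact (img_coeq f).
  transitivity (img f ∘ (q ∘ (x ∘ e2))); [now rewrite (comp_assoc (img f) q), Hf|].
  transitivity (img f ∘ (q ∘ y)); [|now rewrite (comp_assoc (img f) q), Hf].
  now rewrite (comp_assoc q x e2), Hx, Hy, <- comp_assoc,
    (comp_assoc (img f) u), E, !comp_assoc. }
destruct (pb_univ (pbP f f) K) as [w [[H1 H2] _]].
apply (regular_epi_epi He1), (regular_epi_epi He2).
rewrite <- Hx, <- Hy, <- comp_assoc, <- H1, <- H2, !comp_assoc.
unfold q; now rewrite (coeq_comm (coeqP f)).
Qed.

Arguments img_mono {X Y} f {W u v} _.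

Lemma img_le (X Y M : C) (f : hom X Y) (m : hom M Y) (k : hom X M) :
  mono m -> m ∘ k = f -> exists u : hom (coeq f) M, m ∘ u = img f.
Proof.
intros Hm E.
assert (K : k ∘ pb1 f f = k ∘ pb2 f f).
{ apply Hm; rewrite !comp_assoc, E; exact (pb_comm (pbP f f)). }
destruct (coeq_univ (coeqP f) K) as [u [Hu _]]; exists u.
apply (regular_epi_epi (coeq_map_regular f)).
now rewrite <- comp_assoc, Hu, img_coeq.
Qed.

Record relation (X Y : C) : Type := Relation {
  rel_obj : C;
  rel_map : hom rel_obj (bprod X Y);
  rel_mono : mono rel_map
}.

Arguments rel_mono {X Y} r {W u v} _.

Definition rel1 (X Y : C) (r : relation X Y) : hom (rel_obj r) X :=
  pr1 X Y ∘ rel_map r.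
Definition rel2 (X Y : C) (r : relation X Y) : hom (rel_obj r) Y :=
  pr2 X Y ∘ rel_map r.

Definition rel_le (X Y : C) (r s : relation X Y) : Prop :=
  exists u : hom (rel_obj r) (rel_obj s), rel_map s ∘ u = rel_map r.

(** Equality of relations is equality as subobjects of [X × Y]. *)
Definition rel_eq (X Y : C) (r s : relation X Y) : Prop :=
  rel_le r s /\ rel_le s r.

Lemma rel_joint (X Y : C) (r : relation X Y) (W : C) (u v : hom W (rel_obj r)) :
  rel1 r ∘ u = rel1 r ∘ v -> rel2 r ∘ u = rel2 r ∘ v -> u = v.
Proof.
unfold rel1, rel2; rewrite <- !comp_assoc; intros H1 H2.
exact (rel_mono r (bprod_ext H1 H2)).
Qed.

Lemma rel_op_subproof (X Y : C) (r : relation X Y) :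
  mono (pairing (rel2 r) (rel1 r)).
Proof. apply pairing_mono; intros W u v H1 H2; exact (rel_joint H2 H1). Qed.

Definition rel_op (X Y : C) (r : relation X Y) : relation Y X :=
  Relation (@rel_op_subproof _ _ r).

(** [rel_comp s r] is the composite [s r]: first [r], then [s]. *)
Definition rel_comp (X Y Z : C) (s : relation Y Z) (r : relation X Y) :
    relation X Z :=
  Relation (@img_mono _ _ (pairing (rel1 r ∘ pb1 (rel2 r) (rel1 s))
                              (rel2 s ∘ pb2 (rel2 r) (rel1 s)))).

Lemma graph_subproof (X Y : C) (f : hom X Y) : mono (pairing (idm X) f).
Proof. apply pairing_mono; intros W u v H _; now rewrite !comp_id_l in H. Qed.

Definition graph (X Y : C) (f : hom X Y) : relation X Y :=
  Relation (@graph_subproof _ _ f).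

Lemma kernel_pair_subproof (X Y : C) (f : hom X Y) :
  mono (pairing (pb1 f f) (pb2 f f)).
Proof. apply pairing_mono; intros W u v H1 H2; exact (pb_ext (pbP f f) H1 H2). Qed.

Definition kernel_pair (X Y : C) (f : hom X Y) : relation X X :=
  Relation (@kernel_pair_subproof _ _ f).

Lemma kernel_pairE (X Y : C) (f : hom X Y) :
  rel_eq (kernel_pair f) (rel_comp (rel_op (graph f)) (graph f)).
Proof.
assert (G2 : rel2 (graph f) = f) by exact (pr2_pairing _ _).
assert (G1 : rel1 (graph f) = idm X) by exact (pr1_pairing _ _).
assert (O1 : rel1 (rel_op (graph f)) = f) by (etransitivity; [exact (pr1_pairing _ _)|exact G2]).
assert (O2 : rel2 (rel_op (graph f)) = idm X) by (etransitivity; [exact (pr2_pairing _ _)|exact G1]).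
split.
- assert (K : rel2 (graph f) ∘ pb1 f f = rel1 (rel_op (graph f)) ∘ pb2 f f).
  { rewrite G2, O1; exact (pb_comm (pbP f f)). }
  destruct (pb_univ (pbP _ _) K) as [w [[H1 H2] _]].
  exists (coeq_map _ ∘ w); cbn [rel_map rel_comp].
  rewrite comp_assoc, img_coeq.
  apply bprod_ext; cbn [rel_map kernel_pair].
  + now rewrite comp_assoc, !pr1_pairing, <- comp_assoc, H1, G1, comp_id_l.
  + now rewrite comp_assoc, !pr2_pairing, <- comp_assoc, H2, O2, comp_id_l.
- assert (Q : forall (V : C) (p1 p2 : hom V X),
    rel2 (graph f) ∘ p1 = rel1 (rel_op (graph f)) ∘ p2 -> f ∘ p1 = f ∘ p2).
  { rewrite G2, O1; auto. }
  assert (K := Q _ _ _ (pb_comm (pbP (rel2 (graph f)) (rel1 (rel_op (graph f)))))).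
  clear Q.
  destruct (pb_univ (pbP f f) K) as [w [[H1 H2] _]].
  apply (img_le (k := w)); [exact (@rel_mono _ _ (kernel_pair f))|]; cbn [rel_map kernel_pair].
  apply bprod_ext; rewrite comp_assoc.
  + rewrite !pr1_pairing, H1; symmetry.
    exact (eq_trans (f_equal (fun h => h ∘ _) G1) (comp_id_l _)).
  + rewrite !pr2_pairing, H2; symmetry.
    exact (eq_trans (f_equal (fun h => h ∘ _) O2) (comp_id_l _)).
Qed.

End Relations.

(** * Multi-pointed categories and stars *)

Record ideal (C : category) : Type := Ideal {
  in_ideal :> forall X Y : C, hom X Y -> Prop;
  ideal_comp : forall (X Y Z : C) (g : hom Y Z) (f : hom X Y),
    in_ideal g \/ in_ideal f -> in_ideal (g ∘ f)
}.

Record is_kernel (C : category) (N : ideal C) (X Y K : C) (f : hom X Y)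
    (n : hom K X) : Type := IsKernel {
  ker_in : N _ _ (f ∘ n);
  ker_univ : forall (W : C) (h : hom W X), N _ _ (f ∘ h) ->
    {u : hom W K | unique (fun u => n ∘ u = h) u}
}.

Record regular_multi_pointed_category_with_kernels : Type :=
  RegularMultiPointedCategoryWithKernels {
  mcat :> regular_category;
  null : ideal mcat;
  ker : forall (X Y : mcat) (f : hom X Y), mcat;
  ker_map : forall (X Y : mcat) (f : hom X Y), hom (ker f) X;
  kerP : forall (X Y : mcat) (f : hom X Y), is_kernel null f (ker_map f)
}.

Arguments null {_}.

Section Stars.
Context {C : regular_multi_pointed_category_with_kernels}.

Lemma ker_mono (X Y : C) (f : hom X Y) : mono (ker_map f).
Proof.
intros W u v E.
assert (H : null _ _ (f ∘ (ker_map f ∘ v))).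
{ rewrite comp_assoc; apply ideal_comp; left; exact (ker_in (kerP f)). }
destruct (ker_univ (kerP f) H) as [w [_ Hw]].
now rewrite <- (Hw u), <- (Hw v).
Qed.

Lemma star_diag_subproof (X : C) :
  mono (pairing (ker_map (idm X)) (ker_map (idm X))).
Proof. apply pairing_mono; intros W u v H _; exact (ker_mono H). Qed.

(** The relation [(n_{1_X}, n_{1_X})] on [X]. *)
Definition star_diag (X : C) : relation X X := Relation (@star_diag_subproof X).

Definition star (X Y : C) (r : relation X Y) : relation X Y :=
  rel_comp r (star_diag X).

End Stars.

Definition two_star_permutable
    (C : regular_multi_pointed_category_with_kernels) : Prop :=
  forall (X Y Z : C) (f : hom X Y) (g : hom X Z),
    regular_epi f -> regular_epi g ->
    rel_eq (rel_comp (kernel_pair f) (star (kernel_pair g)))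
           (rel_comp (kernel_pair g) (star (kernel_pair f))).

(** The square
<<
         c
     X ----> A
   g | ^ t f | ^ s
     v |     v |
     D ----> B
         d
>>
*)
Record split_square (C : category) (A B X D : C)
    (c : hom X A) (d : hom D B) (g : hom X D) (t : hom D X)
    (f : hom A B) (s : hom B A) : Prop := SplitSquare {
  split_square_top : regular_epi c;
  split_square_bottom : regular_epi d;
  split_square_left : g ∘ t = idm D;
  split_square_right : f ∘ s = idm B;
  split_square_down : f ∘ c = d ∘ g;
  split_square_up : c ∘ t = s ∘ d
}.

(* Main.v *)
From Stdlib Require Import Setoid.
Require Import Defs.

(** Relations in a regular category can be computed with elements: a relation
    from [X] to [Y] is determined by the pairs [x : W -> X], [y : W -> Y] that it
    relates ([rel_leP]), and an existential statement about elements holds when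
    it holds after precomposition with some regular epimorphism ([related_local],
    [related_comp]).  Starring a relation restricts its first argument to
    elements in the ideal ([related_star]).  In this language the theorem becomes
    a short diagram chase.

    Permutability reads: for null [x], if [f x = f y] and [g y = g z] then there
    is [w] with [g x = g w] and [f w = f z] (and the same with [f] and [g]
    exchanged).  The star-regular pushout property reads: for null [x] in [D] and
    [a] in [A] with [f a = d x], there is [w] with [g w = x] and [c w = a]; the
    converse always holds, because the square commutes.

    From permutability to split squares: cover [a] by [z] with [c z = a].  The
    element [t x] is null because the ideal absorbs composition, and
    [c (t x) = s (d x) = s (f a) = c (t (g z))] while [t (g z)] and [z] agree
    under [g].  So [t x] and [z] are related by [Eq(g) Eq(c)^*]; exchanging [c]
    and [g] gives [w] with [g w = g (t x) = x] and [c w = c z = a].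

    From split squares to permutability: let [A] be the image of [Eq(g)] under
    [f], a reflexive relation on the codomain of [f].  The map from [Eq(g)] to
    [A] together with the first projections, split by the diagonals, forms a
    split square over [f].  Applied to the null [x] and to the image of the pair
    [(y, z)] in [A], its pushout property returns a pair [(x, w)] of [Eq(g)] with
    the same image, hence [f w = f z]. *)

Local Open Scope cat_scope.

(** * Elements of relations *)

Section Elements.
Context {C : regular_category}.

Definition related {X Y : C} (r : relation X Y) {W : C} (x : hom W X)
    (y : hom W Y) : Prop :=
  exists u : hom W (rel_obj r), rel1 r ∘ u = x /\ rel2 r ∘ u = y.

Lemma related_pairing {X Y : C} (r : relation X Y) {W : C} (x : hom W X)
    (y : hom W Y) :
  related r x y <-> exists u : hom W (rel_obj r), rel_map r ∘ u = pairing x y.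
Proof.
unfold related, rel1, rel2; split; intros [u Hu]; exists u.
- destruct Hu as [Hx Hy]; apply bprod_ext; rewrite comp_assoc.
  + rewrite pr1_pairing; exact Hx.
  + rewrite pr2_pairing; exact Hy.
- rewrite <- !comp_assoc, Hu.
  split; [apply pr1_pairing | apply pr2_pairing].
Qed.

(** Yoneda for subobjects: only the generic pair, the two projections of [r],
    has to be tested. *)
Lemma rel_leP {X Y : C} (r s : relation X Y) :
  rel_le r s <->
  forall (W : C) (x : hom W X) (y : hom W Y), related r x y -> related s x y.
Proof.
split.
- intros [u Hu] W x y [v [<- <-]].
  exists (u ∘ v).
  unfold rel1, rel2; rewrite <- Hu, !comp_assoc; auto.
- intros H.
  destruct (H _ (rel1 r) (rel2 r)) as [u [H1 H2]].
  { exists (idm _); rewrite !comp_id_r; auto. }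
  exists u; apply bprod_ext; rewrite comp_assoc; [exact H1 | exact H2].
Qed.

(** A regular epimorphism is orthogonal to every monomorphism. *)
Lemma regular_epi_descent {V W M Y : C} (e : hom V W) (m : hom M Y)
    (h : hom W Y) (u : hom V M) :
  regular_epi e -> mono m -> m ∘ u = h ∘ e -> exists v : hom W M, m ∘ v = h.
Proof.
intros He Hm E.
pose proof He as (K & a & b & [Hc]).
assert (Hu : u ∘ a = u ∘ b).
{ apply Hm; rewrite !comp_assoc, E, <- !comp_assoc, (coeq_comm Hc); reflexivity. }
destruct (coeq_univ Hc Hu) as [v [Hv _]].
exists v; apply (regular_epi_epi He).
rewrite <- comp_assoc, Hv; exact E.
Qed.

(** Descent along [e] against the monomorphism representing [r].  Nested covers
    are discharged with it one at a time, instead of being composed. *)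
Lemma related_local {X Y : C} (r : relation X Y) {V W : C} (e : hom V W)
    (x : hom W X) (y : hom W Y) :
  regular_epi e -> related r (x ∘ e) (y ∘ e) -> related r x y.
Proof.
rewrite !related_pairing; intros He [u Hu].
apply (regular_epi_descent e (rel_map r) _ u He (@rel_mono _ _ _ r)).
rewrite Hu; apply bprod_ext; rewrite comp_assoc.
- rewrite !pr1_pairing; reflexivity.
- rewrite !pr2_pairing; reflexivity.
Qed.

(** Stability of regular epimorphisms lets elements of the codomain be lifted,
    up to a cover of their domain. *)
Lemma regular_epi_lift {X Q W : C} (q : hom X Q) (a : hom W Q) :
  regular_epi q ->
  exists (V : C) (e : hom V W) (x : hom V X), regular_epi e /\ q ∘ x = a ∘ e.
Proof.
intros Hq.
exists (pb q a), (pb2 q a), (pb1 q a); split.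
- exact (regular_epi_stable (pbP q a) Hq).
- exact (pb_comm (pbP q a)).
Qed.

Lemma related_comp_intro {X Y Z : C} (s : relation Y Z) (r : relation X Y)
    {W : C} (x : hom W X) (y : hom W Y) (z : hom W Z) :
  related r x y -> related s y z -> related (rel_comp s r) x z.
Proof.
intros [u [Hx Hy]] [v [Hy' Hz]].
destruct (pb_univ (pbP (rel2 r) (rel1 s)) (eq_trans Hy (eq_sym Hy')))
  as [w [[H1 H2] _]].
apply related_pairing; exists (coeq_map _ ∘ w); cbn [rel_map rel_comp].
rewrite comp_assoc, img_coeq; apply bprod_ext; rewrite comp_assoc.
- rewrite !pr1_pairing, <- comp_assoc, H1; exact Hx.
- rewrite !pr2_pairing, <- comp_assoc, H2; exact Hz.
Qed.

Lemma related_comp {X Y Z : C} (s : relation Y Z) (r : relation X Y)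
    {W : C} (x : hom W X) (z : hom W Z) :
  related (rel_comp s r) x z <->
  exists (V : C) (e : hom V W) (y : hom V Y),
    regular_epi e /\ related r (x ∘ e) y /\ related s y (z ∘ e).
Proof.
split.
- (* The composite is an image, so its elements lift to the pullback of the
     two relations only locally. *)
  intros H; apply related_pairing in H; destruct H as [u Hu].
  pose (p := pairing (rel1 r ∘ pb1 (rel2 r) (rel1 s))
                     (rel2 s ∘ pb2 (rel2 r) (rel1 s))).
  destruct (regular_epi_lift (coeq_map p) u (coeq_map_regular p))
    as (V & e & w & He & E).
  exists V, e, (rel2 r ∘ (pb1 (rel2 r) (rel1 s) ∘ w)).
  assert (Hp : p ∘ w = pairing x z ∘ e).
  { rewrite <- (img_coeq p), <- comp_assoc, E, comp_assoc.
    exact (f_equal (fun h => h ∘ e) Hu). }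
  split; [exact He | split].
  + exists (pb1 (rel2 r) (rel1 s) ∘ w); split; [| reflexivity].
    apply (f_equal (fun h => pr1 _ _ ∘ h)) in Hp; unfold p in Hp.
    rewrite !comp_assoc, !pr1_pairing in Hp.
    rewrite comp_assoc; exact Hp.
  + exists (pb2 (rel2 r) (rel1 s) ∘ w); split.
    * rewrite !comp_assoc, (pb_comm (pbP (rel2 r) (rel1 s))); reflexivity.
    * apply (f_equal (fun h => pr2 _ _ ∘ h)) in Hp; unfold p in Hp.
      rewrite !comp_assoc, !pr2_pairing in Hp.
      rewrite comp_assoc; exact Hp.
- intros (V & e & y & He & Hr & Hs).
  apply (related_local _ e); [exact He |].
  exact (related_comp_intro _ _ _ _ _ Hr Hs).
Qed.

Lemma related_op {X Y : C} (r : relation X Y) {W : C} (y : hom W Y) (x : hom W X) :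
  related (rel_op r) y x <-> related r x y.
Proof.
assert (O1 : rel1 (rel_op r) = rel2 r) by exact (pr1_pairing _ _).
assert (O2 : rel2 (rel_op r) = rel1 r) by exact (pr2_pairing _ _).
unfold related; rewrite O1, O2.
split; intros [u [H1 H2]]; exists u; auto.
Qed.

Lemma related_graph {X Y : C} (f : hom X Y) {W : C} (x : hom W X) (y : hom W Y) :
  related (graph f) x y <-> f ∘ x = y.
Proof.
assert (G1 : rel1 (graph f) = idm X) by exact (pr1_pairing _ _).
assert (G2 : rel2 (graph f) = f) by exact (pr2_pairing _ _).
unfold related; rewrite G1, G2; split.
- intros [u [<- <-]]; rewrite comp_id_l; reflexivity.
- intros <-; exists x; rewrite comp_id_l; auto.
Qed.

Lemma related_kernel_pair {X Y : C} (f : hom X Y) {W : C} (x y : hom W X) :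
  related (kernel_pair f) x y <-> f ∘ x = f ∘ y.
Proof.
assert (K1 : rel1 (kernel_pair f) = pb1 f f) by exact (pr1_pairing _ _).
assert (K2 : rel2 (kernel_pair f) = pb2 f f) by exact (pr2_pairing _ _).
unfold related; rewrite K1, K2; split.
- intros [u [<- <-]]; rewrite !comp_assoc.
  exact (f_equal (fun h => h ∘ u) (pb_comm (pbP f f))).
- intros E; destruct (pb_univ (pbP f f) E) as [u [Hu _]]; exists u; exact Hu.
Qed.

(** A split epimorphism is the coequaliser of the identity and the idempotent
    of its splitting. *)
Lemma split_epi_regular {X Y : C} (g : hom X Y) (t : hom Y X) :
  g ∘ t = idm Y -> regular_epi g.
Proof.
intros E.
exists X, (idm X), (t ∘ g); constructor; split.
- rewrite comp_id_r, comp_assoc, E, comp_id_l; reflexivity.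
- intros Z h H; rewrite comp_id_r in H.
  exists (h ∘ t); split.
  + rewrite <- comp_assoc; symmetry; exact H.
  + intros v <-; rewrite <- comp_assoc, E, comp_id_r; reflexivity.
Qed.

End Elements.

(** * Stars and the two conditions, elementwise *)

Section Stars.
Context {C : regular_multi_pointed_category_with_kernels}.

Lemma related_star_diag {X W : C} (x y : hom W X) :
  related (star_diag X) x y <-> null W X x /\ x = y.
Proof.
assert (S1 : rel1 (star_diag X) = ker_map (idm X)) by exact (pr1_pairing _ _).
assert (S2 : rel2 (star_diag X) = ker_map (idm X)) by exact (pr2_pairing _ _).
unfold related; rewrite S1, S2; split.
- intros [u [<- <-]]; split; [| reflexivity].
  apply ideal_comp; left.
  rewrite <- (comp_id_l (ker_map _)); exact (ker_in (kerP (idm X))).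
- intros [Hx <-].
  rewrite <- (comp_id_l x) in Hx.
  destruct (ker_univ (kerP (idm X)) Hx) as [u [Hu _]]; exists u; auto.
Qed.

(** An element is null when it is so on a cover: the null elements of [X] are
    those that factor through the kernel of the identity, a monomorphism. *)
Lemma null_local {V W X : C} (e : hom V W) (x : hom W X) :
  regular_epi e -> null V X (x ∘ e) -> null W X x.
Proof.
intros He Hx.
apply (related_star_diag x x), (related_local _ e _ _ He), related_star_diag; auto.
Qed.

Lemma related_star {X Y : C} (r : relation X Y) {W : C} (x : hom W X) (y : hom W Y) :
  related (star r) x y <-> null W X x /\ related r x y.
Proof.
unfold star; split.
- intros H; apply related_comp in H; destruct H as (V & e & x' & He & Hd & Hr).
  apply related_star_diag in Hd; destruct Hd as [Hx <-].
  split; [exact (null_local e x He Hx) | exact (related_local r e x y He Hr)].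
- intros [Hx Hr]; apply (related_comp_intro _ _ x x y); [| exact Hr].
  apply related_star_diag; auto.
Qed.

Lemma related_kernel_pair_star_kernel_pair {X Y Z : C} (f : hom X Y) (g : hom X Z)
    {W : C} (x z : hom W X) :
  related (rel_comp (kernel_pair f) (star (kernel_pair g))) x z <->
  null W X x /\
  exists (V : C) (e : hom V W) (y : hom V X),
    regular_epi e /\ g ∘ (x ∘ e) = g ∘ y /\ f ∘ y = f ∘ (z ∘ e).
Proof.
rewrite related_comp; split.
- intros (V & e & y & He & Hg & Hf).
  apply related_star in Hg; destruct Hg as [Hx Hg].
  split; [exact (null_local e x He Hx) |].
  apply related_kernel_pair in Hg, Hf.
  exists V, e, y; auto.
- intros [Hx (V & e & y & He & Hg & Hf)].
  exists V, e, y; split; [exact He |].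
  rewrite related_star, !related_kernel_pair.
  split; [split; [apply ideal_comp; auto | exact Hg] | exact Hf].
Qed.

Lemma related_graph_star_op {X A D : C} (c : hom X A) (g : hom X D)
    {W : C} (x : hom W D) (a : hom W A) :
  related (rel_comp (graph c) (star (rel_op (graph g)))) x a <->
  null W D x /\
  exists (V : C) (e : hom V W) (w : hom V X),
    regular_epi e /\ g ∘ w = x ∘ e /\ c ∘ w = a ∘ e.
Proof.
rewrite related_comp; split.
- intros (V & e & w & He & Hg & Hc).
  apply related_star in Hg; destruct Hg as [Hx Hg].
  split; [exact (null_local e x He Hx) |].
  apply related_op, related_graph in Hg; apply related_graph in Hc.
  exists V, e, w; auto.
- intros [Hx (V & e & w & He & Hg & Hc)].
  exists V, e, w; split; [exact He |].
  rewrite related_star, related_op, !related_graph.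
  split; [split; [apply ideal_comp; auto | exact Hg] | exact Hc].
Qed.

Lemma related_op_graph_star {A D B : C} (f : hom A B) (d : hom D B)
    {W : C} (x : hom W D) (a : hom W A) :
  related (rel_comp (rel_op (graph f)) (star (graph d))) x a <->
  null W D x /\ f ∘ a = d ∘ x.
Proof.
split.
- intros H; apply related_comp in H; destruct H as (V & e & b & He & Hd & Hf).
  apply related_star in Hd; destruct Hd as [Hx Hd].
  apply related_graph in Hd; apply related_op, related_graph in Hf.
  split; [exact (null_local e x He Hx) |].
  apply (regular_epi_epi He).
  rewrite <- !comp_assoc, Hd; exact Hf.
- intros [Hx E]; apply (related_comp_intro _ _ x (d ∘ x) a).
  + rewrite related_star, related_graph; auto.
  + rewrite related_op, related_graph; exact E.
Qed.

(** * Permutability and split squares *)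

Lemma star_pushout_of_two_star_permutable {X A D B : C} (c : hom X A)
    (d : hom D B) (g : hom X D) (t : hom D X) (f : hom A B) (s : hom B A) :
  two_star_permutable C -> split_square c d g t f s ->
  rel_eq (rel_comp (graph c) (star (rel_op (graph g))))
         (rel_comp (rel_op (graph f)) (star (graph d))).
Proof.
intros HP [Hc Hd Hgt Hfs Hdown Hup].
split; apply rel_leP; intros W x a; rewrite related_graph_star_op, related_op_graph_star.
- intros [Hx (V & e & w & He & Hg & Ha)]; split; [exact Hx |].
  apply (regular_epi_epi He).
  rewrite <- !comp_assoc, <- Hg, <- Ha, !comp_assoc, Hdown; reflexivity.
- intros [Hx E].
  destruct (regular_epi_lift c a Hc) as (V & e & z & He & Hz).
  assert (Hperm : related (rel_comp (kernel_pair g) (star (kernel_pair c)))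
                    (t ∘ (x ∘ e)) z).
  { apply related_kernel_pair_star_kernel_pair; split.
    - apply ideal_comp; right; apply ideal_comp; auto.
    - exists V, (idm V), (t ∘ (g ∘ z)); repeat split.
      + apply (split_epi_regular (idm V) (idm V)), comp_id_l.
      + (* both sides are [s (f (a e))] *)
        rewrite comp_id_r, !(comp_assoc c t), Hup, <- !comp_assoc.
        f_equal.
        rewrite (comp_assoc d g z), <- Hdown, <- comp_assoc, Hz, !comp_assoc, E.
        reflexivity.
      + rewrite comp_id_r, (comp_assoc g t), Hgt, comp_id_l; reflexivity. }
  pose proof (split_epi_regular g t Hgt) as Hg.
  destruct (HP _ _ _ c g Hc Hg) as [_ Hle].
  apply (proj1 (rel_leP _ _) Hle) in Hperm.
  (* The witness lives over a cover of [V]; [related_local] brings the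
     conclusion back to [V] and then to [W]. *)
  apply related_graph_star_op, (related_local _ e _ _ He).
  apply related_kernel_pair_star_kernel_pair in Hperm.
  destruct Hperm as [_ (V' & e' & w & He' & Hw1 & Hw2)].
  apply related_graph_star_op; split; [apply ideal_comp; auto |].
  exists V', e', w; repeat split; [exact He' | |].
  + rewrite <- Hw1, !comp_assoc, Hgt, comp_id_l; reflexivity.
  + rewrite Hw2, comp_assoc, Hz; reflexivity.
Qed.

(** The image of the kernel pair of [g] along [f] is a relation on [Y]; it is
    reflexive because the diagonal of [X] lies in the kernel pair and membership
    descends along the regular epimorphism [f].  This gives the splitting. *)
Lemma split_square_kernel_pair_image {X Y Z : C} (f : hom X Y) (g : hom X Z) :
  regular_epi f ->
  exists (t : hom X (pb g g))
      (s : hom Y (coeq (pairing (f ∘ pb1 g g) (f ∘ pb2 g g)))),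
    split_square (coeq_map (pairing (f ∘ pb1 g g) (f ∘ pb2 g g))) f (pb1 g g) t
      (pr1 Y Y ∘ img (pairing (f ∘ pb1 g g) (f ∘ pb2 g g))) s.
Proof.
intros Hf.
set (p := pairing (f ∘ pb1 g g) (f ∘ pb2 g g)).
destruct (pb_univ (pbP g g) (eq_refl (g ∘ idm X))) as [t [[Ht1 Ht2] _]].
assert (Ep : p ∘ t = pairing (idm Y) (idm Y) ∘ f).
{ apply bprod_ext; unfold p; rewrite !comp_assoc.
  - rewrite !pr1_pairing, <- comp_assoc, Ht1, comp_id_l, comp_id_r; reflexivity.
  - rewrite !pr2_pairing, <- comp_assoc, Ht2, comp_id_l, comp_id_r; reflexivity. }
assert (Hd : img p ∘ (coeq_map p ∘ t) = pairing (idm Y) (idm Y) ∘ f).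
{ rewrite comp_assoc, img_coeq; exact Ep. }
destruct (regular_epi_descent f (img p) _ _ Hf (@img_mono _ _ _ p) Hd) as [s Hs].
exists t, s; split.
- apply coeq_map_regular.
- exact Hf.
- exact Ht1.
- rewrite <- comp_assoc, Hs; apply pr1_pairing.
- rewrite <- comp_assoc, img_coeq; apply pr1_pairing.
- apply (@img_mono _ _ _ p); rewrite Hd, comp_assoc, Hs; reflexivity.
Qed.

Lemma permute_of_star_pushout {X Y Z : C} (f : hom X Y) (g : hom X Z) :
  (forall (X A D B : C) (c : hom X A) (d : hom D B) (g : hom X D) (t : hom D X)
      (f : hom A B) (s : hom B A),
    split_square c d g t f s ->
    rel_eq (rel_comp (graph c) (star (rel_op (graph g))))
           (rel_comp (rel_op (graph f)) (star (graph d)))) ->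
  regular_epi f ->
  rel_le (rel_comp (kernel_pair g) (star (kernel_pair f)))
         (rel_comp (kernel_pair f) (star (kernel_pair g))).
Proof.
intros HS Hf.
destruct (split_square_kernel_pair_image f g Hf) as (t & s & Hsq).
destruct (HS _ _ _ _ _ _ _ _ _ _ Hsq) as [_ Hle]; clear HS Hsq.
set (p := pairing (f ∘ pb1 g g) (f ∘ pb2 g g)) in *.
apply rel_leP; intros W x z H.
apply related_kernel_pair_star_kernel_pair in H.
destruct H as [Hx (V & e & y & He & Hxy & Hyz)].
apply (related_local _ e _ _ He).
destruct (pb_univ (pbP g g) Hyz) as [yz [[H1 H2] _]].
assert (Hpush : related (rel_comp (rel_op (graph (pr1 Y Y ∘ img p))) (star (graph f)))
                  (x ∘ e) (coeq_map p ∘ yz)).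
{ apply related_op_graph_star; split; [apply ideal_comp; auto |].
  rewrite comp_assoc, <- (comp_assoc _ _ (coeq_map p)), img_coeq.
  unfold p; rewrite pr1_pairing, <- comp_assoc, H1, Hxy; reflexivity. }
apply (proj1 (rel_leP _ _) Hle), related_graph_star_op in Hpush.
destruct Hpush as [Hxe (V' & e' & xw & He' & Hxw & Hc)].
apply related_kernel_pair_star_kernel_pair; split; [exact Hxe |].
exists V', e', (pb2 g g ∘ xw); repeat split; [exact He' | |].
- rewrite <- Hxw, !comp_assoc, (pb_comm (pbP g g)); reflexivity.
- (* second components of the equality of the two images in [Y × Y] *)
  apply (f_equal (fun h => pr2 Y Y ∘ (img p ∘ h))) in Hc.
  rewrite <- (comp_assoc (coeq_map p)), !(comp_assoc (img p)), img_coeq in Hc.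
  unfold p in Hc; rewrite !(comp_assoc (pr2 Y Y)), !pr2_pairing in Hc.
  rewrite comp_assoc, Hc, <- H2, !comp_assoc; reflexivity.
Qed.

End Stars.

Theorem proposition2p4 (C : regular_multi_pointed_category_with_kernels) :
  two_star_permutable C <->
  (forall (X A D B : C) (c : hom X A) (d : hom D B) (g : hom X D) (t : hom D X)
      (f : hom A B) (s : hom B A),
    split_square c d g t f s ->
    rel_eq (rel_comp (graph c) (star (rel_op (graph g))))
           (rel_comp (rel_op (graph f)) (star (graph d)))).
Proof.
split.
- intros HP X A D B c d g t f s.
  exact (star_pushout_of_two_star_permutable c d g t f s HP).
- intros HS X Y Z f g Hf Hg; split.
  + exact (permute_of_star_pushout g f HS Hg).
  + exact (permute_of_star_pushout f g HS Hf).
Qed.
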